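(* Let $\{(X(t),Y(t))\}_{t\ge0}$ be a standard orthogonal planar random motion with speed $c>0$ and rate function $\lambda(t)\in C^2\bigl((0,\infty),[0,\infty)\bigr)$. The marginal processes $X(t)$ and $Y(t)$ are each equal in distribution to the one-dimensional process $\mathcal{T}(t)$, $t\ge0$, with velocity $c$ and rate function $\lambda(t)$ (the three-velocity motion defined in the context).
   Context: Directions: $d_k=(\cos(k\pi/2),\sin(k\pi/2))$, $k=0,1,2,3$, with indices taken modulo 4. The standard orthogonal planar random motion with speed $c$ and rate function $\lambda$ is the position $(X(t),Y(t))$ of a particle that starts at the origin at time $0$ with initial direction uniformly distributed on $\{d_0,d_1,d_2,d_3\}$, moves with velocity $c\,d_k$ as long as its current direction is $d_k$, and at each event of a non-homogeneous Poisson process with rate function $\lambda(t)$ switches from its current direction $d_k$ to $d_{k+1}$ or $d_{k-1}$, each with probability $1/2$ (independently of everything else). The process $\mathcal{T}$ with velocity $c$ and rate function $\lambda(t)$: let $N$ be a non-homogeneous Poisson process with rate function $\lambda(t)$, and let $V_0$ be independent of $N$ with $P\{V_0=c\}=P\{V_0=-c\}=1/4$, $P\{V_0=0\}=1/2$. The velocity $V(t)$ has $V(0)=V_0$, is constant between events of $N$, and at each event of $N$: if the current velocity is $0$, it becomes $c$ or $-c$, each with probability $1/2$; if the current velocity is $\pm c$, it becomes $0$ with probability $1$. Then $\mathcal{T}(t)=\int_0^tV(s)\,ds$. *)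

(* Defs.v *)
From mathcomp Require Import all_boot all_order all_algebra.
From mathcomp Require Import all_classical all_reals all_analysis.
Set Implicit Arguments.
Unset Strict Implicit.
Unset Printing Implicit Defensive.
Import Order.TTheory GRing.Theory Num.Theory.
Import numFieldNormedType.Exports.
Local Open Scope classical_set_scope.
Local Open Scope ring_scope.

(* Processes are indexed by all of R, but only times t >= 0 are ever constrained
   or compared. *)

(* lam \in C^2(]0, +oo[, [0, +oo[); nothing is assumed at or near 0. *)
Definition rate_function (R : realType) (lam : R -> R) : Prop :=
  forall t : R, 0 < t ->
    [/\ 0 <= lam t, derivable lam t 1, derivable (derive1 lam) t 1
      & {for t, continuous (derive1n 2 lam)}].

Section processes.
Context d (T : measurableType d) (R : realType) (P : probability T R).

(* N t is the number of events in ]0, t].  As N is finite-valued, the Poisson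
   means have to be finite; this is the only integrability required of lam.
   The mass function is spelled out because the library's poisson_pmf is
   constantly 1 when the mean is 0.  Jumps of size greater than 1 have
   probability 0 and are not excluded pathwise. *)
Record poisson_process (lam : R -> R) (N : R -> T -> nat) : Prop := {
  poisson_measurable : forall t k, 0 <= t -> measurable [set w | N t w = k] ;
  poisson_start : forall w, N 0 w = 0%N ;
  poisson_monotone : forall w s t, 0 <= s -> s <= t -> (N s w <= N t w)%N ;
  poisson_right_continuous :
    forall w t, 0 <= t -> \forall s \near t^'+, N s w = N t w ;
  poisson_increment : forall s t, 0 <= s -> s <= t ->
    exists m : R,
      (\int[lebesgue_measure]_(u in `]s, t]) (lam u)%:E)%E = m%:E /\
      forall k : nat, P [set w | (N t w - N s w)%N = k] =
        (m ^+ k / k`!%:R * expR (- m))%:E ;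
  poisson_independent_increments :
    forall (n : nat) (t : nat -> R) (k : nat -> nat),
      0 <= t 0%N -> (forall i, t i <= t i.+1) ->
      P [set w | forall i, (i < n)%N -> (N (t i.+1) w - N (t i) w)%N = k i] =
      (\prod_(i < n) P [set w | (N (t i.+1) w - N (t i) w)%N = k i])%E }.

Definition process_sigma_algebra (N : R -> T -> nat) : set (set T) :=
  <<s [set A | exists (t : R) (k : nat), 0 <= t /\ A = [set w | N t w = k]] >>.

(* Z n is the state right after the n-th event of N (Z 0 is the initial state).
   St is the finite state space.  The law of the next state given the previous
   ones and the whole process N is p (current state), and Z 0 is independent
   of N with law init. *)
Record event_chain (N : R -> T -> nat) (S : choiceType) (St : seq S)
    (init : S -> R) (p : S -> S -> R) (Z : nat -> T -> S) : Prop := {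
  chain_state : forall n w, Z n w \in St ;
  chain_measurable : forall n z, measurable [set w | Z n w = z] ;
  chain_initial : forall (A : set T) (z : S),
    process_sigma_algebra N A -> z \in St ->
    P (A `&` [set w | Z 0%N w = z]) = (P A * (init z)%:E)%E ;
  chain_transition : forall (A : set T) (n : nat) (z : nat -> S),
    process_sigma_algebra N A -> (forall i, z i \in St) ->
    P (A `&` [set w | forall i, (i <= n.+1)%N -> Z i w = z i]) =
    (P (A `&` [set w | forall i, (i <= n)%N -> Z i w = z i])
      * (p (z n) (z n.+1))%:E)%E }.

Definition direction (k : 'Z_4) : R * R :=
  (cos ((k : nat)%:R * pi / 2), sin ((k : nat)%:R * pi / 2)).

Definition direction_init (k : 'Z_4) : R := 1 / 4.

Definition direction_step (k l : 'Z_4) : R :=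
  if (l == k + 1) || (l == k - 1) then 1 / 2 else 0.

Definition orthogonal_motion (c : R) (lam : R -> R) (X Y : R -> T -> R) : Prop :=
  exists (N : R -> T -> nat) (D : nat -> T -> 'Z_4),
    [/\ poisson_process lam N,
        event_chain N (enum 'Z_4) direction_init direction_step D,
        forall t w, 0 <= t -> X t w =
          \int[lebesgue_measure]_(s in `[0, t]) (c * (direction (D (N s w) w)).1)
      & forall t w, 0 <= t -> Y t w =
          \int[lebesgue_measure]_(s in `[0, t]) (c * (direction (D (N s w) w)).2)].

Definition velocity_init (v : R) : R := if v == 0 then 1 / 2 else 1 / 4.

Definition velocity_step (c v v' : R) : R :=
  if v == 0 then (if (v' == c) || (v' == - c) then 1 / 2 else 0)
  else (if v' == 0 then 1 else 0).

Definition three_velocity_motion (c : R) (lam : R -> R) (U : R -> T -> R) : Prop :=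
  exists (N : R -> T -> nat) (V : nat -> T -> R),
    [/\ poisson_process lam N,
        event_chain N [:: c; - c; 0] velocity_init (velocity_step c) V
      & forall t w, 0 <= t -> U t w =
          \int[lebesgue_measure]_(s in `[0, t]) V (N s w) w].

End processes.

(* The product sigma-algebra of R^[0, +oo[, on paths R -> R. *)
Definition path_sigma_algebra (R : realType) : set (set (R -> R)) :=
  <<s [set E | exists (t : R) (B : set R),
         [/\ 0 <= t, measurable B & E = [set x : R -> R | B (x t)]]] >>.

(* Equality of laws as processes, not merely of one-dimensional marginals. *)
Definition equal_in_distribution (R : realType)
    d1 (T1 : measurableType d1) (P1 : probability T1 R) (X1 : R -> T1 -> R)
    d2 (T2 : measurableType d2) (P2 : probability T2 R) (X2 : R -> T2 -> R) : Prop :=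
  forall E : set (R -> R), @path_sigma_algebra R E ->
    P1 [set w | E (fun t => X1 t w)] = P2 [set w | E (fun t => X2 t w)].

(* Main.v *)
From HB Require Import structures.
Require Import Defs.
From mathcomp Require Import all_boot all_order all_algebra.
From mathcomp Require Import all_classical all_reals all_analysis.
From mathcomp Require Import measurable_realfun ring lra.
Set Implicit Arguments.
Unset Strict Implicit.
Unset Printing Implicit Defensive.
Import Order.TTheory GRing.Theory Num.Theory.
Import numFieldNormedType.Exports.
Local Open Scope classical_set_scope.
Local Open Scope ring_scope.

(** Each coordinate of the direction chain takes the values [c], [0], [-c]
    only.  Projecting the four directions to one axis glues the two
    perpendicular directions into the velocity [0], and both of them move to
    [c] and to [-c] with probability [1/2] each, while the other two move to
    the glued state with probability [1].  So the projected chain is strongly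
    lumpable ([event_chain_lump], [projection_lump]): with the same Poisson
    process it is an event chain with the initial law and the transitions of
    the three-velocity motion.  It remains to see that a Poisson process and
    an event chain on it determine the law of the integrated motion, even when
    they live on different probability spaces ([motion_law_unique]).

    For this, both motions are factored through one canonical space, that of
    the pairs (counting path, sequence of velocities), with the sigma-algebra
    of its cylinders.  The cylinders form a pi-system, and their probability
    is determined: independent increments give the finite-dimensional laws of
    the counting process ([poisson_values_law]), and the Markov property
    given the whole counting process gives the factor coming from the chain
    ([measure_history]).  Hence the two laws on the canonical space agree
    ([driving_path_law]).

    The position at time [t] is a measurable function of the canonical pair.
    Measurability is not visible on an integral over time, but the velocity
    is a bounded function of time which is constant just after each instant,
    so the integral is the limit of its right-endpoint Riemann sums
    ([right_riemann_sum_cvg]), and each of these involves finitely many times.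
    The upper limit of these sums is measurable on the whole canonical space,
    and equals the position on the paths of the motion ([position]). *)

(** * Riemann sums of functions constant just after each instant *)

Section right_riemann_sum.
Context {R : realType}.

Definition grid (t : R) (n i : nat) : R := t * i%:R / n.+1%:R.

Definition right_riemann_sum (q : R -> R) (t : R) (n : nat) : R :=
  \sum_(i < n.+1) q (grid t n i.+1) * (t / n.+1%:R).

Definition grid_cell (t : R) (n i : nat) : set R :=
  `]grid t n i, grid t n i.+1]%classic.

Definition right_step (q : R -> R) (t : R) (n : nat) (s : R) : R :=
  \sum_(i < n.+1) q (grid t n i.+1) * \1_(grid_cell t n i) s.

Lemma grid_ge0 (t : R) n i : 0 <= t -> 0 <= grid t n i.
Proof. by move=> t0; rewrite /grid !mulr_ge0// invr_ge0. Qed.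

Lemma grid_end (t : R) n : grid t n n.+1 = t.
Proof. by rewrite /grid mulfK. Qed.

Lemma grid_le (t : R) n i j : 0 <= t -> (i <= j)%N -> grid t n i <= grid t n j.
Proof. by move=> t0 ij; rewrite /grid ler_pM2r ?invr_gt0// ler_wpM2l// ler_nat. Qed.

Lemma gridS (t : R) n i : grid t n i.+1 = grid t n i + t / n.+1%:R.
Proof. by rewrite /grid -natr1; field. Qed.

(** The cells are half-open on the left because the values are taken at the
    right ends; this is why the time [0] is excluded. *)
Lemma grid_cell_exists (t s : R) n : 0 < s <= t ->
  exists2 i, (i < n.+1)%N & grid_cell t n i s.
Proof.
move=> /andP[s0 st].
have ex : exists i, s <= grid t n i by exists n.+1; rewrite grid_end.
case: (ex_minnP ex) => -[|i] si imin.
  by move: si; rewrite /grid mulr0 mul0r leNgt s0.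
exists i; first by apply: imin; rewrite grid_end.
rewrite /grid_cell /= in_itv /= si andbT ltNge.
by apply/negP => /imin; rewrite ltnn.
Qed.

Lemma right_step_cell (q : R -> R) (t s : R) n i : 0 <= t -> (i < n.+1)%N ->
  grid_cell t n i s -> right_step q t n s = q (grid t n i.+1).
Proof.
move=> t0 iltn si; rewrite /right_step (bigD1 (Ordinal iltn))//= big1 => [|j jNi].
  by rewrite indicE mem_set// mulr1 addr0.
rewrite indicE memNset ?mulr0// => sj.
move: si sj; rewrite /grid_cell /= !in_itv /= => /andP[si1 si2] /andP[sj1 sj2].
have : (j : nat) != i by apply: contra jNi => /eqP ji; apply/eqP/val_inj.
rewrite neq_ltn => /orP[] /(grid_le n t0) /le_lt_trans h.
  by have := h _ si1; rewrite ltNge sj2.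
by have := h _ sj1; rewrite ltNge si2.
Qed.

Lemma right_step_close (q : R -> R) (t s : R) n : 0 < s <= t ->
  exists2 u, s <= u < s + t / n.+1%:R & right_step q t n s = q u.
Proof.
move=> st; have [i iltn si] := grid_cell_exists n st.
have t0 : 0 <= t by move/andP: st => [s0 st]; exact: le_trans (ltW s0) st.
exists (grid t n i.+1); last exact: right_step_cell.
move: si; rewrite /grid_cell /= in_itv /= => /andP[si1 ->] /=.
by rewrite gridS ltrD2r.
Qed.

(** The right end of the cell of [s] tends to [s] from the right, and [q] is
    constant just after [s]: the sequence is eventually constant. *)
Lemma right_step_cvg (q : R -> R) (t s : R) : 0 < s <= t ->
  (\forall u \near s^'+, q u = q s) -> right_step q t n s @[n --> \oo] --> q s.
Proof.
move=> st qs; apply: cvg_near_cst.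
have [e /= e0 he] : exists2 e, 0 < e & forall u, s < u -> u < s + e -> q u = q s.
  move: qs => [e /= e0 he]; exists e => // u su us; apply: he => //=.
  by rewrite ltr0_norm ?subr_lt0// opprB ltrBlDl.
have t0 : 0 < t by move/andP: st => [s0 st]; exact: lt_le_trans s0 st.
near=> n.
have [u /andP[su us] ->] := right_step_close q n st.
move: su; rewrite le_eqVlt => /predU1P[->//|su]; apply: he => //.
apply: lt_trans us _; rewrite ltrD2l ltr_pdivrMr// -ltr_pdivrMl//.
near: n.
exists (Num.truncn (e^-1 * t)).+1 => // n /= hn.
apply: (lt_le_trans (truncnS_gt _)); rewrite ler_nat.
exact: leq_trans hn _.
Unshelve. all: by end_near. Qed.

Lemma right_step_bound (q : R -> R) (C t s : R) n : 0 < s <= t ->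
  (forall u, `|q u| <= C) -> `|right_step q t n s| <= C.
Proof. by move=> st qC; have [u _ ->] := right_step_close q n st. Qed.

Lemma integral_right_step (q : R -> R) (t : R) n : 0 <= t ->
  (\int[lebesgue_measure]_(s in `]0%R, t]) (right_step q t n s)%:E)%E =
  (right_riemann_sum q t n)%:E.
Proof.
move=> t0.
have mu_cell i : (i < n.+1)%N ->
    lebesgue_measure (grid_cell t n i `&` `]0, t]) = (t / n.+1%:R)%:E.
  move=> iltn; rewrite setIidl.
    rewrite /grid_cell lebesgue_measure_itv/= lte_fin.
    rewrite -EFinB gridS [_ + _ - _]addrAC subrr add0r ltrDl.
    case: ltP => // t1; congr EFin; apply/eqP; rewrite eq_le t1 andbT.
    by rewrite mulr_ge0.
  move=> x; rewrite /grid_cell /= !in_itv /= => /andP[x1 x2].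
  rewrite (le_lt_trans _ x1) ?grid_ge0//=.
  by rewrite (le_trans x2)// -[leRHS](grid_end t n) grid_le.
have icell i : lebesgue_measure.-integrable (`]0, t]%classic : set R)
    (EFin \o (\1_(grid_cell t n i) : R -> R)).
  apply: (@integrableS _ _ _ lebesgue_measure setT) => //.
  exact: integrable_indic_itv.
under eq_integral do rewrite /right_step -sumEFin.
rewrite integral_sum//; last first.
  by move=> i; apply: (integrableZl _ _ (icell i)).
rewrite -sumEFin; apply: eq_bigr => i _.
under eq_integral do rewrite EFinM.
rewrite integralZl//; last exact: icell.
rewrite integral_indic//; last exact: measurable_itv.
by rewrite EFinM; congr (_ * _)%E; exact: mu_cell.
Qed.

(** The Riemann sum is the integral of a step function dominated by [C], so
    pointwise convergence of the step functions suffices; it also gives the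
    measurability of [q]. *)
Lemma right_riemann_sum_cvg (q : R -> R) (C t : R) : 0 <= t ->
  (forall s, `|q s| <= C) ->
  (forall s, 0 <= s -> \forall u \near s^'+, q u = q s) ->
  right_riemann_sum q t n @[n --> \oo] -->
    (\int[lebesgue_measure]_(s in `[0, t]) q s).
Proof.
move=> t0 qC qr.
have pt s : `]0, t]%classic s -> right_step q t n s @[n --> \oo] --> q s.
  rewrite /= in_itv /= => st; apply: right_step_cvg => //.
  by apply: qr; move/andP: st => [/ltW].
have mstep n : measurable_fun (`]0, t]%classic : set R) (right_step q t n).
  apply: measurable_sum => i; apply: measurable_funM => //.
  by apply: measurable_indic; exact: measurable_itv.
have mq : measurable_fun (`]0, t]%classic : set R) q.
  exact: (measurable_fun_cvg mstep pt).
have fmu : (lebesgue_measure (`]0%R, t]%classic : set R) < +oo)%E.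
  by rewrite lebesgue_measure_itv/=; case: ifP => // _; rewrite -EFinB ltry.
have qbd : [bounded q s | s in (`]0, t]%classic : set R)].
  exists C; split => [|M CM s _ /=]; first exact: num_real.
  exact: le_trans (qC s) (ltW CM).
have iq : lebesgue_measure.-integrable (`]0, t]%classic : set R) (EFin \o q).
  exact: measurable_bounded_integrable.
rewrite -Rintegral_itv_obnd_cbnd//.
have : (\int[lebesgue_measure]_(s in `]0%R, t]) (right_step q t n s)%:E)%E
    @[n --> \oo] --> (\int[lebesgue_measure]_(s in `]0%R, t]) (q s)%:E)%E.
  apply: (@dominated_cvg _ _ _ lebesgue_measure _ _ _ _ (cst C%:E)) => //.
  - by move=> n; apply/measurable_EFinP; exact: mstep.
  - by move=> s hs; apply: cvg_EFin; [exact: nearW|exact: pt].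
  - apply: measurable_bounded_integrable => //.
    exists `|C|; split => [|M CM s _ /=]; first exact: num_real.
    exact: ltW.
  - move=> n s; rewrite /= in_itv /= => st.
    by rewrite lee_fin right_step_bound.
under eq_fun do rewrite integral_right_step//.
move=> h; rewrite /Rintegral.
apply: (@fine_cvg _ _ _ _ (fun n => (right_riemann_sum q t n)%:E)).
by rewrite fineK//; exact: integrable_fin_num.
Qed.

End right_riemann_sum.

(** * Event chains: histories and lumping *)

Section finite_partition.
Context d (T : measurableType d) (R : realType) (mu : {measure set T -> \bar R}).

Lemma measure_partition (S : eqType) (St : seq S) (h : T -> S) (M : set T) :
  uniq St -> (forall w, h w \in St) ->
  (forall z, measurable [set w | h w = z]) -> measurable M ->
  mu M = (\sum_(z <- St) mu (M `&` [set w | h w = z]))%E.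
Proof.
move=> uSt hSt mh mM.
have meas (s : seq S) : measurable [set w | h w \in s].
  elim: s => [|x s IH]; first by rewrite (_ : mkset _ = set0)// -subset0.
  rewrite (_ : mkset _ = [set w | h w = x] `|` [set w | h w \in s]).
    exact: measurableU.
  by apply/seteqP; split=> w /=; rewrite inE; [move/predU1P|move=> ?; apply/predU1P].
suff H (s : seq S) : uniq s -> mu (M `&` [set w | h w \in s]) =
    (\sum_(z <- s) mu (M `&` [set w | h w = z]))%E.
  by rewrite -H//; congr (mu _); apply/seteqP; split=> w //= [].
elim: s => [_|x s IH /= /andP[xs us]].
  by rewrite big_nil (_ : _ `&` _ = set0) ?measure0// -subset0 => w [].
rewrite big_cons -IH// -measureU//.
- congr (mu _); rewrite -setIUr; congr (M `&` _).
  by apply/seteqP; split=> w /=; rewrite inE; [move/predU1P|move=> ?; apply/predU1P].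
- exact: measurableI.
- exact: measurableI.
- rewrite -subset0 => w [] [_ hx] [_ hs]; move: hs; rewrite /= hx; exact/negP.
Qed.

End finite_partition.

Section chain_histories.
Context d (T : measurableType d) (R : realType) (P : probability T R).
Context (N : R -> T -> nat) (S : choiceType) (St : seq S).
Context (init : S -> R) (p : S -> S -> R) (Z : nat -> T -> S).
Hypothesis chainZ : event_chain P N St init p Z.

(** A finite history, extended to all indices by the default value of
    [inord], so that it is a sequence of states as in the axioms of an event
    chain. *)
Definition history n (e : {ffun 'I_n.+1 -> seq_sub St}) (i : nat) : S :=
  val (e (inord i)).

Lemma history_state n (e : {ffun 'I_n.+1 -> seq_sub St}) i : history e i \in St.
Proof. exact: valP. Qed.

Lemma measurable_chain_in (B : set S) n : measurable [set w | B (Z n w)].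
Proof.
rewrite (_ : mkset _ =
    \bigcup_(z in [set` St] `&` B) [set w | Z n w = z]); last first.
  apply/seteqP; split=> [w Bw|w [z [_ Bz] /= Zz]]; last by rewrite /= Zz.
  by exists (Z n w) => //; split => //=; exact: chain_state chainZ _ _.
apply: fin_bigcup_measurable; first exact/finite_setIl/finite_seq.
by move=> z _; exact: chain_measurable chainZ _ _.
Qed.

Lemma measurable_history (B : nat -> set S) n :
  measurable [set w | forall i, (i <= n)%N -> B i (Z i w)].
Proof.
rewrite (_ : mkset _ =
    \bigcap_(i in [set i | (i <= n)%N]) [set w | B i (Z i w)]).
  by apply: bigcap_measurable => [|i _]; [exists 0%N|exact: measurable_chain_in].
by apply/seteqP; split.
Qed.

(** Events about the first states are finite disjoint unions of completely
    specified histories, the only events whose probability the axioms of an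
    event chain give. *)
Lemma measure_history_split (M : set T) (B : nat -> set S) n : measurable M ->
  P (M `&` [set w | forall i, (i <= n)%N -> B i (Z i w)]) =
  (\sum_(e : {ffun 'I_n.+1 -> seq_sub St} |
          `[< forall i, (i <= n)%N -> B i (history e i) >])
    P (M `&` [set w | forall i, (i <= n)%N -> Z i w = history e i]))%E.
Proof.
move=> mM.
pose h w : {ffun 'I_n.+1 -> seq_sub St} :=
  [ffun i : 'I_n.+1 => SeqSub (chain_state chainZ i w)].
have hE e : [set w | h w = e] =
    [set w | forall i, (i <= n)%N -> Z i w = history e i].
  apply/seteqP; split=> w /=.
    by move=> <- i lein; rewrite /history ffunE /= inordK.
  move=> Ze; apply/ffunP => i; apply: val_inj; rewrite ffunE /=.
  by rewrite Ze /history ?inord_val// -ltnS.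
rewrite (@measure_partition _ _ _ _ _ (enum {ffun 'I_n.+1 -> seq_sub St}) h).
- rewrite big_enum [RHS]big_mkcond; apply: eq_bigr => e _.
  rewrite hE; case: asboolP => Be.
    congr (P _); rewrite -setIA; congr (M `&` _); apply/seteqP.
    by split=> [w [_ He//]|w /= He]; split => // i lein; rewrite He//; exact: Be.
  rewrite (_ : _ `&` _ = set0) ?measure0// -subset0 => w [[_ /= Bw]] He.
  by apply: Be => i lein; rewrite -He//; exact: Bw.
- exact: enum_uniq.
- by move=> w; rewrite mem_enum.
- by move=> e; rewrite hE; exact: (measurable_history (fun i => [set history e i])).
- by apply: measurableI => //; exact: measurable_history.
Qed.

Lemma measure_history (A : set T) (z : nat -> S) n :
  process_sigma_algebra N A -> (forall i, z i \in St) ->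
  P (A `&` [set w | forall i, (i <= n)%N -> Z i w = z i]) =
  (P A * (init (z 0%N) * \prod_(i < n) p (z i) (z i.+1))%:E)%E.
Proof.
move=> NA zSt; elim: n => [|n IH].
  rewrite big_ord0 mulr1 -(chain_initial chainZ)//.
  congr (P (_ `&` _)); apply/seteqP; split=> w /=; first exact.
  by move=> Z0 i; rewrite leqn0 => /eqP ->.
rewrite (chain_transition chainZ)// IH -muleA -EFinM -mulrA.
by rewrite big_ord_recr.
Qed.

(** Strong lumpability: when the total probability of moving into each fibre
    of [f] depends on the present state only through its image, the image
    chain is again an event chain.  Summing the transition axiom over all
    histories with the prescribed image gives the claim, since the lumped
    transition probability does not depend on the history. *)
Lemma event_chain_lump (S' : choiceType) (St' : seq S') (f : S -> S')
    (init' : S' -> R) (p' : S' -> S' -> R) :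
  process_sigma_algebra N `<=` measurable -> uniq St ->
  {in St, forall x, f x \in St'} ->
  {in St', forall y, \sum_(x <- St | f x == y) init x = init' y} ->
  {in St & St', forall x y, \sum_(x' <- St | f x' == y) p x x' = p' (f x) y} ->
  event_chain P N St' init' p' (fun n w => f (Z n w)).
Proof.
move=> mN uSt fSt lump_init lump_step.
have split_last (M : set T) n y : measurable M ->
    P (M `&` [set w | f (Z n w) = y]) =
    (\sum_(x <- St | f x == y) P (M `&` [set w | Z n w = x]))%E.
  move=> mM; rewrite (@measure_partition _ _ _ _ _ St (Z n)) => //.
  - rewrite [RHS]big_mkcond; apply: eq_bigr => x _; case: eqP => fx.
      congr (P _); rewrite -setIA; congr (M `&` _); apply/seteqP.
      by split=> [w []//|w /= Zx]; rewrite Zx.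
    by rewrite (_ : _ `&` _ = set0) ?measure0// -subset0 => w [[_ /=] + Zx]; rewrite Zx.
  - exact: chain_state chainZ _.
  - exact: chain_measurable chainZ _.
  - by apply: measurableI => //; exact: (measurable_chain_in [set x | f x = y]).
have sum_mul (M : set T) (Q : pred S) (F : S -> R) : measurable M ->
    (\sum_(x <- St | Q x) (P M * (F x)%:E) =
     P M * (\sum_(x <- St | Q x) F x)%:E)%E.
  move=> mM; rewrite -(fineK (fin_num_measure P _ mM)) -EFinM mulr_sumr -sumEFin.
  by apply: eq_bigr => x _; rewrite EFinM.
split.
- by move=> n w; apply: fSt; exact: chain_state chainZ _ _.
- by move=> n y; exact: (measurable_chain_in [set x | f x = y]).
- move=> A y NA ySt'; have mA := mN _ NA.
  rewrite split_last// -(lump_init _ ySt') -sum_mul//.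
  rewrite big_seq_cond [RHS]big_seq_cond; apply: eq_bigr => x /andP[xSt _].
  exact: chain_initial chainZ _ _ _ _.
- move=> A n z NA zSt'; have mA := mN _ NA.
  set Mlast := A `&` [set w | f (Z n.+1 w) = z n.+1].
  have mlast : measurable Mlast.
    by apply: measurableI => //; exact: (measurable_chain_in [set x | f x = z n.+1]).
  rewrite (_ : _ `&` _ = Mlast `&`
      [set w | forall i, (i <= n)%N -> [set x | f x = z i] (Z i w)]); last first.
    apply/seteqP; split=> w /=.
      by move=> [Aw fw]; split; [split => //; exact: fw|move=> i /leqW; exact: fw].
    move=> [[Aw fl] fw]; split => // i; rewrite leq_eqVlt => /predU1P[->//|].
    exact: fw.
  rewrite (measure_history_split (fun i => [set x | f x = z i]) n mlast).
  rewrite (measure_history_split (fun i => [set x | f x = z i]) n mA).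
  set C := fun e : {ffun 'I_n.+1 -> seq_sub St} =>
    A `&` [set w | forall i, (i <= n)%N -> Z i w = history e i].
  have mC e : measurable (C e).
    apply: measurableI => //.
    exact: (measurable_history (fun i => [set history e i])).
  rewrite (eq_bigr (fun e => P (C e) * (p' (z n) (z n.+1))%:E)%E) => [|e /asboolP fe].
    rewrite (eq_bigr (fun e => (fine (P (C e)) * p' (z n) (z n.+1))%:E)) => [|e _].
      rewrite sumEFin -mulr_suml EFinM -sumEFin; congr (_ * _)%E.
      by apply: eq_bigr => e _; rewrite fineK//; exact: fin_num_measure.
    by rewrite EFinM fineK//; exact: fin_num_measure.
  rewrite /Mlast setIAC -/(C e) split_last//.
  rewrite -(fe n (leqnn n)) -(lump_step _ _ (history_state e n) (zSt' _)) -sum_mul//.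
  rewrite big_seq_cond [RHS]big_seq_cond; apply: eq_bigr => x /andP[xSt _].
  (* the history [e] followed by the state [x], as an infinite sequence *)
  pose zx i := if (i <= n)%N then history e i else x.
  have zxn i : (i <= n)%N -> zx i = history e i by rewrite /zx => ->.
  have zxS : zx n.+1 = x by rewrite /zx ltnn.
  have CE : C e = A `&` [set w | forall i, (i <= n)%N -> Z i w = zx i].
    congr (A `&` _); apply/seteqP.
    by split=> w /= H i lein; have := H i lein; rewrite zxn.
  rewrite -{2}zxS -(zxn n)// CE -(chain_transition chainZ)//; last first.
    by move=> i; rewrite /zx; case: ifP => // _; exact: history_state.
  congr (P _); rewrite -setIA; congr (A `&` _); apply/seteqP; split=> w /=.
    by move=> [H Hx] i; rewrite leq_eqVlt => /predU1P[->|/H//]; rewrite zxS.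
  by move=> H; split=> [i /leqW/H//|]; rewrite H// zxS.
Qed.

End chain_histories.

(** * The finite-dimensional laws of a Poisson process *)

Section poisson_paths.
Context d (T : measurableType d) (R : realType) (P : probability T R).
Context (lam : R -> R) (N : R -> T -> nat).
Hypothesis poissonN : poisson_process P lam N.

Lemma process_sigma_algebra_measurable : process_sigma_algebra N `<=` measurable.
Proof.
apply: smallest_sub; first exact: sigma_algebra_measurable.
by move=> _ [t [k [t0 ->]]]; exact: poisson_measurable poissonN _ _ _.
Qed.

Lemma process_sigma_algebra_values (s : seq (R * nat)) :
  (forall x, x \in s -> 0 <= x.1) ->
  process_sigma_algebra N [set w | forall x, x \in s -> N x.1 w = x.2].
Proof.
elim: s => [|x s IH] s0.
  rewrite (_ : mkset _ = setT); last by apply/seteqP; split.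
  exact: (@measurableT _ (g_sigma_algebraType _)).
rewrite (_ : mkset _ = [set w | N x.1 w = x.2] `&`
    [set w | forall x, x \in s -> N x.1 w = x.2]); last first.
  apply/seteqP; split=> w /=.
    move=> H; split=> [|y ys]; apply: H; rewrite inE ?eqxx//.
    by rewrite ys orbT.
  by move=> [Hx Hs] y; rewrite inE => /predU1P[->|/Hs].
apply: (@measurableI _ (g_sigma_algebraType _)).
  apply: sub_sigma_algebra; exists x.1, x.2; split => //.
  by apply: s0; rewrite mem_head.
by apply: IH => y ys; apply: s0; rewrite inE ys orbT.
Qed.

(** Monotonicity of the paths makes the truncated differences genuine
    increments; a prescription of values that decreases somewhere is
    contradictory on both sides. *)
Lemma values_of_increments (t : nat -> R) (k : nat -> nat) n w :
  t 0%N = 0 -> (forall i, t i <= t i.+1) -> k 0%N = 0%N ->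
  (forall i, (i < n)%N -> N (t i.+1) w = k i.+1) <->
  (forall i, (i < n)%N -> (k i <= k i.+1)%N /\
     (N (t i.+1) w - N (t i) w)%N = (k i.+1 - k i)%N).
Proof.
move=> t0 tS k0.
have tpos i : 0 <= t i by elim: i => [|i IH]; [rewrite t0|exact: le_trans IH (tS i)].
have Nle i : (N (t i) w <= N (t i.+1) w)%N by exact: poisson_monotone poissonN _ _ _ _ _.
split=> H.
  have Hk i : (i <= n)%N -> N (t i) w = k i.
    by case: i => [_|i /H//]; rewrite t0 k0 (poisson_start poissonN).
  move=> i ilt; have Hi := Hk i (ltnW ilt); have HiS := Hk i.+1 ilt.
  by split; rewrite -Hi -HiS.
suff Hk i : (i <= n)%N -> N (t i) w = k i by move=> i ilt; exact: Hk.
elim: i => [_|i IH ilt]; first by rewrite t0 k0 (poisson_start poissonN).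
have [ki Ni] := H _ ilt.
by rewrite -(subnK (Nle i)) Ni IH ?subnK// ltnW.
Qed.

End poisson_paths.

Section poisson_law.
Context d1 (T1 : measurableType d1) (R : realType) (P1 : probability T1 R).
Context d2 (T2 : measurableType d2) (P2 : probability T2 R).
Context (lam : R -> R) (N1 : R -> T1 -> nat) (N2 : R -> T2 -> nat).
Hypotheses (poissonN1 : poisson_process P1 lam N1)
  (poissonN2 : poisson_process P2 lam N2).

Lemma poisson_increment_law s t k : 0 <= s -> s <= t ->
  P1 [set w | (N1 t w - N1 s w)%N = k] = P2 [set w | (N2 t w - N2 s w)%N = k].
Proof.
move=> s0 st.
have [m1 [m1E ->]] := poisson_increment poissonN1 s0 st.
have [m2 [m2E ->]] := poisson_increment poissonN2 s0 st.
by move: m1E; rewrite m2E => -[->].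
Qed.

Lemma poisson_ordered_values_law (t : nat -> R) (k : nat -> nat) n :
  t 0%N = 0 -> (forall i, t i <= t i.+1) -> k 0%N = 0%N ->
  P1 [set w | forall i, (i < n)%N -> N1 (t i.+1) w = k i.+1] =
  P2 [set w | forall i, (i < n)%N -> N2 (t i.+1) w = k i.+1].
Proof.
move=> t0 tS k0.
have tpos i : 0 <= t i by elim: i => [|i IH]; [rewrite t0|exact: le_trans IH (tS i)].
have [kS|kS] := pselect (forall i, (i < n)%N -> (k i <= k i.+1)%N); last first.
  (* a decreasing target value is incompatible with the monotone paths *)
  rewrite (_ : mkset _ = set0); last first.
    rewrite -subset0 => w /(values_of_increments poissonN1 n w t0 tS k0) H.
    by apply: kS => i /H[].
  rewrite measure0 (_ : mkset _ = set0) ?measure0//.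
  rewrite -subset0 => w /(values_of_increments poissonN2 n w t0 tS k0) H.
  by apply: kS => i /H[].
rewrite (_ : mkset _ = [set w | forall i, (i < n)%N ->
    (N1 (t i.+1) w - N1 (t i) w)%N = (k i.+1 - k i)%N]); last first.
  apply/seteqP; split=> w /=.
    by move/(values_of_increments poissonN1 n w t0 tS k0) => H i /H[].
  move=> H; apply/(values_of_increments poissonN1 n w t0 tS k0) => i ilt.
  by split; [exact: kS|exact: H].
rewrite [in RHS](_ : mkset _ = [set w | forall i, (i < n)%N ->
    (N2 (t i.+1) w - N2 (t i) w)%N = (k i.+1 - k i)%N]); last first.
  apply/seteqP; split=> w /=.
    by move/(values_of_increments poissonN2 n w t0 tS k0) => H i /H[].
  move=> H; apply/(values_of_increments poissonN2 n w t0 tS k0) => i ilt.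
  by split; [exact: kS|exact: H].
rewrite (poisson_independent_increments poissonN1 n (t := t)
  (fun i => k i.+1 - k i)%N)// (poisson_independent_increments poissonN2 n (t := t)
  (fun i => k i.+1 - k i)%N)//.
by apply: eq_bigr => i _; exact: poisson_increment_law.
Qed.

(** The prescribed values come in any order, possibly with repetitions: sorting
    them by time does not change the event, and starting from time [0], where
    the process vanishes, turns it into an event on increments. *)
Lemma poisson_values_law (s : seq (R * nat)) :
  (forall x, x \in s -> 0 <= x.1) ->
  P1 [set w | forall x, x \in s -> N1 x.1 w = x.2] =
  P2 [set w | forall x, x \in s -> N2 x.1 w = x.2].
Proof.
move=> s0.
pose leT (x y : R * nat) := x.1 <= y.1.
have leT_total : total leT by move=> x y; exact: le_total.
pose s' := (0, 0%N) :: sort leT s.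
(* [t] is constant after the last prescribed time, so that it is monotone *)
pose t i := (nth (0, 0%N) s' (minn i (size s))).1.
pose k i := (nth (0, 0%N) s' i).2.
have tS i : t i <= t i.+1.
  have [ilt|lei] := ltnP i (size s); last first.
    by rewrite /t !(minn_idPr _)// leqW.
  rewrite /t (minn_idPl ilt) (minn_idPl (ltnW ilt)).
  have : path leT (0, 0%N) (sort leT s).
    rewrite path_min_sorted ?sort_sorted//.
    by apply/allP => x; rewrite mem_sort => /s0.
  by move/(pathP (0, 0%N)) => /(_ i); rewrite size_sort; apply.
have valE d (T : measurableType d) (N : R -> T -> nat) :
    [set w | forall x, x \in s -> N x.1 w = x.2] =
    [set w | forall i, (i < size s)%N -> N (t i.+1) w = k i.+1].
  apply/seteqP; split=> w /= H.
    move=> i ilt; rewrite /t (minn_idPl ilt) /k; apply: H.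
    by rewrite -(mem_sort leT) [nth _ _ _]/(nth _ (sort leT s) i) mem_nth// size_sort.
  move=> x; rewrite -(mem_sort leT) => /(nthP (0, 0%N))[i].
  rewrite size_sort => ilt <-; have := H _ ilt.
  by rewrite /t (minn_idPl ilt).
rewrite !valE; apply: poisson_ordered_values_law => //.
by rewrite /t min0n.
Qed.

End poisson_law.

(** * The canonical space of counting paths and velocities *)

Section driving_paths.
Context {R : realType}.

Definition driving_path : Type := ((R -> nat) * (nat -> R))%type.
HB.instance Definition _ := Pointed.on driving_path.

(** The velocities are restricted to arbitrary sets, not only to measurable
    ones or to points: they will take finitely many values, and in this form
    the velocity at a given time is measurable on the whole space, including
    sequences that are not velocity sequences of a motion. *)
Definition driving_cylinder (s : seq (R * nat)) (n : nat) (B : nat -> set R) :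
    set driving_path :=
  [set w | (forall x, x \in s -> w.1 x.1 = x.2) /\
           forall i, (i <= n)%N -> B i (w.2 i)].

Definition driving_cylinders : set (set driving_path) :=
  [set A | exists s n B, (forall x, x \in s -> 0 <= x.1) /\
     A = driving_cylinder s n B].

Definition measurable_driving_path := g_sigma_algebraType driving_cylinders.

Lemma driving_cylindersI : setI_closed driving_cylinders.
Proof.
move=> _ _ [s1 [n1 [B1 [s10 ->]]]] [s2 [n2 [B2 [s20 ->]]]].
exists (s1 ++ s2), (maxn n1 n2), (fun i =>
  [set x | ((i <= n1)%N -> B1 i x) /\ ((i <= n2)%N -> B2 i x)]).
split=> [x|]; first by rewrite mem_cat => /orP[/s10|/s20].
apply/seteqP; split=> w /=.
  move=> [[H1 K1] [H2 K2]]; split=> [x|i _].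
    by rewrite mem_cat => /orP[/H1|/H2].
  by split=> [/K1|/K2].
move=> [H K]; split; (split=> [x xs|i lein]; [apply: H; rewrite mem_cat xs ?orbT//|]).
  by have [] := K i; rewrite ?leq_max ?lein// => + _; apply.
by have [] := K i; rewrite ?leq_max ?lein ?orbT// => _; apply.
Qed.

Lemma driving_cylindersT : driving_cylinders setT.
Proof.
by exists [::], 0%N, (fun=> setT); split => //; apply/seteqP; split.
Qed.

Definition velocity_path (w : driving_path) (s : R) : R := w.2 (w.1 s).

(** An upper limit, rather than an integral, is measurable without any
    condition on the path. *)
Definition position (t : R) (w : driving_path) : R :=
  fine (limn_esup (fun n => (right_riemann_sum (velocity_path w) t n)%:E)).

Lemma measurable_velocity_path (s : R) : 0 <= s ->
  measurable_fun setT (velocity_path ^~ s : measurable_driving_path -> R).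
Proof.
move=> s0 _ B mB; rewrite setTI.
(* split according to the number [k] of events up to time [s] *)
rewrite (_ : _ @^-1` _ = \bigcup_k driving_cylinder [:: (s, k)] k
    (fun i => [set x | i = k -> B x])).
  apply: bigcup_measurable => k _; apply: sub_sigma_algebra.
  exists [:: (s, k)], k, (fun i => [set x | i = k -> B x]); split => //.
  by move=> x; rewrite inE => /eqP ->.
apply/seteqP; split=> w /=.
  move=> Bw; exists (w.1 s) => //; split=> [x|i _ /= ->//].
  by rewrite inE => /eqP ->.
move=> [k _ [H K]]; rewrite /velocity_path (H (s, k)) ?mem_head//.
exact: K.
Qed.

Lemma measurable_position (t : R) : 0 <= t ->
  measurable_fun setT (position t : measurable_driving_path -> R).
Proof.
move=> t0; apply: measurableT_comp => //.
apply: measurable_fun_limn_esup => n; apply/measurable_EFinP.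
apply: measurable_sum => i; apply: measurable_funM => //.
by apply: measurable_velocity_path; exact: grid_ge0.
Qed.

Lemma position_integral (w : driving_path) (C t : R) : 0 <= t ->
  (forall n, `|w.2 n| <= C) ->
  (forall s, 0 <= s -> \forall u \near s^'+, w.1 u = w.1 s) ->
  position t w = \int[lebesgue_measure]_(s in `[0, t]) velocity_path w s.
Proof.
move=> t0 wC wr; rewrite /position.
have cv : right_riemann_sum (velocity_path w) t n @[n --> \oo] -->
    \int[lebesgue_measure]_(s in `[0, t]) velocity_path w s.
  apply: (@right_riemann_sum_cvg _ _ C) => [//|s|s s0]; first exact: wC.
  by have := wr _ s0; apply: filterS => u; rewrite /velocity_path => ->.
have cvE : (right_riemann_sum (velocity_path w) t n)%:E @[n --> \oo] -->
    (\int[lebesgue_measure]_(s in `[0, t]) velocity_path w s)%:E.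
  by apply: cvg_EFin; [exact: nearW|exact: cv].
rewrite is_cvg_limn_esupE; last by apply/cvg_ex; eexists; exact: cvE.
by rewrite (cvg_lim _ cvE).
Qed.

End driving_paths.

(** * Uniqueness of the law of a motion *)

Lemma seq_norm_bounded (R : realType) (s : seq R) :
  exists C, forall x, x \in s -> `|x| <= C.
Proof.
elim: s => [|x s [C HC]]; first by exists 0.
exists (Num.max `|x| C) => y; rewrite inE => /predU1P[->|/HC yC].
  by rewrite le_max lexx.
by rewrite le_max yC orbT.
Qed.

(** Sets of paths in the sigma-algebra do not see negative times, at which the
    motions are arbitrary. *)
Lemma path_sigma_algebra_ext (R : realType) (E : set (R -> R)) (x y : R -> R) :
  path_sigma_algebra E -> (forall t, 0 <= t -> x t = y t) -> E x <-> E y.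
Proof.
move=> mE xy; move: E mE; apply: smallest_sub.
  split=> [//|E H|F H]; first by split=> -[_ h]; split=> // /H.
  by split=> -[k _ /H Fk]; exists k.
by move=> _ [t [B [t0 _ ->]]] /=; rewrite xy.
Qed.

Section driving_law.
Context {R : realType} (lam : R -> R) (St : seq R) (init : R -> R) (p : R -> R -> R).

Lemma measurable_driving d (T : measurableType d) (P : probability T R)
    (N : R -> T -> nat) (V : nat -> T -> R) :
  poisson_process P lam N -> event_chain P N St init p V ->
  measurable_fun setT
    (fun w => (N ^~ w, V ^~ w) : @measurable_driving_path R).
Proof.
move=> hN hV; apply: (@measurability _ _ T (@measurable_driving_path R) setT _
  (@driving_cylinders R)) => //.
move=> _ [_ [s [n [B [s0 ->]]]] <-]; rewrite setTI.
rewrite (_ : _ @^-1` _ = [set w | forall x, x \in s -> N x.1 w = x.2] `&`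
  [set w | forall i, (i <= n)%N -> B i (V i w)]); last by apply/seteqP; split.
apply: measurableI; last exact: measurable_history hV _ _.
apply: (process_sigma_algebra_measurable hN).
exact: process_sigma_algebra_values.
Qed.

Context d1 (T1 : measurableType d1) (P1 : probability T1 R)
  (N1 : R -> T1 -> nat) (V1 : nat -> T1 -> R).
Context d2 (T2 : measurableType d2) (P2 : probability T2 R)
  (N2 : R -> T2 -> nat) (V2 : nat -> T2 -> R).
Hypotheses (poissonN1 : poisson_process P1 lam N1)
  (chainV1 : event_chain P1 N1 St init p V1).
Hypotheses (poissonN2 : poisson_process P2 lam N2)
  (chainV2 : event_chain P2 N2 St init p V2).

Lemma driving_cylinder_law s n B : (forall x, x \in s -> 0 <= x.1) ->
  P1 [set w | driving_cylinder s n B (N1 ^~ w, V1 ^~ w)] =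
  P2 [set w | driving_cylinder s n B (N2 ^~ w, V2 ^~ w)].
Proof.
move=> s0.
have N1s := process_sigma_algebra_values (N := N1) s0.
have N2s := process_sigma_algebra_values (N := N2) s0.
have mN1s := process_sigma_algebra_measurable poissonN1 N1s.
have mN2s := process_sigma_algebra_measurable poissonN2 N2s.
rewrite [LHS](measure_history_split chainV1 B n mN1s).
rewrite [RHS](measure_history_split chainV2 B n mN2s).
apply: eq_bigr => e _.
rewrite (measure_history chainV1 n N1s (history_state e)).
rewrite (measure_history chainV2 n N2s (history_state e)).
by congr (_ * _)%E; exact: poisson_values_law poissonN1 poissonN2 _ s0.
Qed.

(** Two probabilities that agree on a pi-system agree on the sigma-algebra it
    generates; here they are the images of [P1] and [P2] on the canonical
    space. *)
Lemma driving_path_law (A : set driving_path) : <<s driving_cylinders >> A ->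
  P1 [set w | A (N1 ^~ w, V1 ^~ w)] = P2 [set w | A (N2 ^~ w, V2 ^~ w)].
Proof.
have m1 := measurable_driving poissonN1 chainV1.
have m2 := measurable_driving poissonN2 chainV2.
pose f1 := mfun_Sub (mem_set m1).
pose f2 := mfun_Sub (mem_set m2).
move=> mA.
apply: (@measure_unique _ R (measurable_driving_path : measurableType _)
  driving_cylinders (fun=> setT) _ _ _ _ (pushforward P1 f1) (pushforward P2 f2)) => //.
- exact: driving_cylindersI.
- by move=> _; exact: driving_cylindersT.
- by rewrite bigcup_const.
- by move=> _ [s [n [B [s0 ->]]]]; exact: driving_cylinder_law.
- by move=> _; rewrite -[X in (X < _)%E]/(P1 setT) probability_setT ltry.
Qed.

Lemma integral_is_position d (T : measurableType d) (P : probability T R)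
    (N : R -> T -> nat) (V : nat -> T -> R) (U : R -> T -> R) :
  poisson_process P lam N -> event_chain P N St init p V ->
  (forall t w, 0 <= t -> U t w =
     \int[lebesgue_measure]_(s in `[0, t]) V (N s w) w) ->
  forall t w, 0 <= t -> U t w = position t (N ^~ w, V ^~ w).
Proof.
move=> hN hV hU t w t0; have [C HC] := seq_norm_bounded St.
rewrite hU// (@position_integral _ _ C)//=.
- by move=> n; apply: HC; exact: chain_state hV _ _.
- by move=> s s0; exact: poisson_right_continuous hN _ _ s0.
Qed.

(** Both motions are the image of their driving pair under the same measurable
    map, and the two pairs have the same law. *)
Lemma motion_law_unique (U1 : R -> T1 -> R) (U2 : R -> T2 -> R) :
  (forall t w, 0 <= t -> U1 t w =
     \int[lebesgue_measure]_(s in `[0, t]) V1 (N1 s w) w) ->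
  (forall t w, 0 <= t -> U2 t w =
     \int[lebesgue_measure]_(s in `[0, t]) V2 (N2 s w) w) ->
  equal_in_distribution P1 U1 P2 U2.
Proof.
move=> hU1 hU2 E mE.
have U1E := integral_is_position poissonN1 chainV1 hU1.
have U2E := integral_is_position poissonN2 chainV2 hU2.
have mPE : <<s driving_cylinders >> [set w : driving_path | E (position ^~ w)].
  move: E mE; apply: smallest_sub.
    split=> [|E H|F H].
    - exact: sigma_algebra0.
    - by rewrite setTD; exact: sigma_algebraC H.
    - exact: (@bigcupT_measurable _ measurable_driving_path _ H).
  move=> _ [t [B [t0 mB ->]]].
  by have := measurable_position t0 measurableT mB; rewrite setTI.
have E1 : [set w | E (U1 ^~ w)] =
    [set w | [set w' | E (position ^~ w')] (N1 ^~ w, V1 ^~ w)].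
  apply/funext => w; apply/propext.
  by apply: (path_sigma_algebra_ext mE) => t t0; exact: U1E.
have E2 : [set w | E (U2 ^~ w)] =
    [set w | [set w' | E (position ^~ w')] (N2 ^~ w, V2 ^~ w)].
  apply/funext => w; apply/propext.
  by apply: (path_sigma_algebra_ext mE) => t t0; exact: U2E.
by rewrite E1 E2; exact: driving_path_law.
Qed.

End driving_law.

(** * Projecting the orthogonal motion to an axis *)

Section directions.
Context {R : realType}.

Lemma enum_Zp4 : enum 'Z_4 = [:: 0; 1; 2; 3].
Proof. by apply: (inj_map val_inj); rewrite val_enum_ord. Qed.

Lemma direction0 : direction R (0 : 'Z_4) = (1, 0).
Proof. by rewrite /direction /= !mul0r cos0 sin0. Qed.

Lemma direction1 : direction R (1 : 'Z_4) = (0, 1).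
Proof. by rewrite /direction /= mul1r cos_pihalf sin_pihalf. Qed.

Lemma direction2 : direction R (2 : 'Z_4) = (- 1, 0).
Proof.
rewrite /direction /= (_ : 2%:R * pi / 2 = pi :> R) ?cospi ?sinpi//.
by field.
Qed.

Lemma direction3 : direction R (3 : 'Z_4) = (0, - 1).
Proof.
rewrite /direction /= (_ : 3%:R * pi / 2 = pi + pi / 2 :> R); last by field.
rewrite cosD sinD cospi sinpi cos_pihalf sin_pihalf.
by rewrite !(mulr0, mul0r, mulN1r, mulr1, subrr, add0r, addr0).
Qed.

End directions.

Section projection.
Context {R : realType} (c : R).
Hypothesis c_gt0 : 0 < c.

Let cN0 : (c == 0) = false. Proof. exact: gt_eqF. Qed.
Let NcN0 : (- c == 0) = false. Proof. by rewrite oppr_eq0. Qed.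
Let cNNc : (c == - c) = false. Proof. by rewrite gt_eqF// gtrN. Qed.
Let NcNc : (- c == c) = false. Proof. by rewrite eq_sym cNNc. Qed.
Let eq0c : (0 == c) = false. Proof. by rewrite eq_sym. Qed.
Let eq0Nc : (0 == - c) = false. Proof. by rewrite eq_sym. Qed.
Let eqE := (cN0, NcN0, cNNc, NcNc, eq0c, eq0Nc, eqxx).

Let velocities : seq R := [:: c; - c; 0].

(** The two cases are the cosine and the sine of the four directions.  Opposite
    directions are two steps apart and perpendicular ones are one step apart,
    so both directions of velocity [0] have the moving directions as their
    neighbours, and conversely. *)
Lemma projection_lump (f : 'Z_4 -> R) :
  [/\ f 0 = c, f 1 = 0, f 2 = - c & f 3 = 0] \/
  [/\ f 0 = 0, f 1 = c, f 2 = 0 & f 3 = - c] ->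
  [/\ {in enum 'Z_4, forall k, f k \in velocities},
    {in velocities, forall v,
      \sum_(k <- enum 'Z_4 | f k == v) direction_init R k = velocity_init v} &
    {in enum 'Z_4 & velocities, forall k v,
      \sum_(l <- enum 'Z_4 | f l == v) direction_step R k l =
      velocity_step c (f k) v}].
Proof.
rewrite enum_Zp4 /velocities => -[] [f0 f1 f2 f3]; (split=> [k|v|k v];
  rewrite !inE; [move=> /or4P[] /eqP ->|move=> /or3P[] /eqP ->|
                 move=> /or4P[] /eqP -> /or3P[] /eqP ->]).
all: rewrite ?big_cons ?big_nil ?f0 ?f1 ?f2 ?f3 ?eqE ?orbT//.
all: rewrite /direction_init /direction_step /velocity_init /velocity_step.
all: rewrite ?eqE /= ?f0 ?f1 ?f2 ?f3 ?eqE /=; lra.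
Qed.

End projection.

Lemma projected_motion_law (R : realType)
    d (T : measurableType d) (P : probability T R)
    d' (T' : measurableType d') (P' : probability T' R)
    (c : R) (lam : R -> R) (N : R -> T -> nat) (D : nat -> T -> 'Z_4)
    (f : 'Z_4 -> R) (X : R -> T -> R) (U : R -> T' -> R) :
  0 < c -> poisson_process P lam N ->
  event_chain P N (enum 'Z_4) (direction_init R) (direction_step R) D ->
  [/\ f 0 = c, f 1 = 0, f 2 = - c & f 3 = 0] \/
  [/\ f 0 = 0, f 1 = c, f 2 = 0 & f 3 = - c] ->
  (forall t w, 0 <= t -> X t w =
    \int[lebesgue_measure]_(s in `[0, t]) f (D (N s w) w)) ->
  three_velocity_motion P' c lam U -> equal_in_distribution P X P' U.
Proof.
move=> c0 hN hD fE hX [N' [V [hN' hV hU]]].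
have [fSt finit fstep] := projection_lump c0 fE.
have chainfD := event_chain_lump hD (process_sigma_algebra_measurable hN)
  (enum_uniq _) fSt finit fstep.
exact: (@motion_law_unique R lam [:: c; - c; 0] (@velocity_init R) (velocity_step c)
  _ _ P N (fun n w => f (D n w)) _ _ P' N' V hN chainfD hN' hV X U hX hU).
Qed.

Theorem corollary2p1 (R : realType)
    (d : measure_display) (T : measurableType d) (P : probability T R)
    (d' : measure_display) (T' : measurableType d') (P' : probability T' R)
    (c : R) (lam : R -> R) (X Y : R -> T -> R) (U : R -> T' -> R)
    (hc : 0 < c) (hlam : rate_function lam)
    (hXY : orthogonal_motion P c lam X Y)
    (hU : three_velocity_motion P' c lam U) :
  equal_in_distribution P X P' U /\ equal_in_distribution P Y P' U.
Proof.
have [N [D [hN hD hX hY]]] := hXY.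
split.
- apply: (projected_motion_law (f := fun k => c * (direction R k).1) hc hN hD) => //.
  by left; rewrite direction0 direction1 direction2 direction3 /= mulr1 mulr0 mulrN1.
- apply: (projected_motion_law (f := fun k => c * (direction R k).2) hc hN hD) => //.
  by right; rewrite direction0 direction1 direction2 direction3 /= mulr1 mulr0 mulrN1.
Qed.
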